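(* For any graph $G$ with no isolated vertex, $$\gamma_{oitR}(G)\leq \alpha(G)+\gamma_R(G)\leq \alpha(G)+2\gamma(G).$$
   Context: All graphs are finite, undirected and simple (no loops or multiple edges). $\alpha(G)$ is the vertex cover number: the minimum cardinality of a set of vertices such that every edge of $G$ is incident to at least one vertex of the set. $\gamma(G)$ is the domination number: the minimum cardinality of a set $D\subseteq V(G)$ such that every vertex in $V(G)\setminus D$ has a neighbor in $D$. For a function $f:V(G)\to\{0,1,2\}$, let $V_i=\{v\in V(G): f(v)=i\}$ for $i\in\{0,1,2\}$; the weight of $f$ is $\omega(f)=\sum_{v\in V(G)}f(v)$. The function $f$ is a Roman dominating function if every vertex in $V_0$ is adjacent to at least one vertex in $V_2$; the Roman domination number $\gamma_R(G)$ is the minimum weight of a Roman dominating function on $G$. The function $f$ (on a graph $G$ with no isolated vertex) is an outer-independent total Roman dominating function if (i) every vertex in $V_0$ is adjacent to at least one vertex in $V_2$; (ii) $V_0$ is an independent set; and (iii) the subgraph induced by $V_1\cup V_2$ has no isolated vertex. The outer-independent total Roman domination number $\gamma_{oitR}(G)$ is the minimum weight among all such functions. *)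

(* Defs.v *)
From mathcomp Require Import all_boot.

Set Implicit Arguments.
Unset Strict Implicit.
Unset Printing Implicit Defensive.

(* A finite simple graph is a symmetric irreflexive relation [e] on a finType
   of vertices; symmetry and irreflexivity are hypotheses where needed. *)

Section GraphParameters.
Variables (T : finType) (e : rel T).
Implicit Types (A S D : {set T}) (f : {ffun T -> 'I_3}).

Definition vertex_cover S : bool :=
  [forall u, forall v, e u v ==> (u \in S) || (v \in S)].

Definition dominating D : bool :=
  [forall v in ~: D, exists u in D, e v u].

Definition independent A : bool :=
  [forall u in A, forall v in A, ~~ e u v].

(* The subgraph induced by A has no isolated vertex. *)
Definition no_isolated A : bool :=
  [forall u in A, exists v in A, e u v].

Definition level f (i : nat) : {set T} := [set v | f v == i :> nat].

Definition weight f : nat := \sum_v f v.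

Definition roman_dominating f : bool :=
  [forall v in level f 0, exists u in level f 2, e v u].

Definition oit_roman_dominating f : bool :=
  [&& roman_dominating f,
      independent (level f 0)
    & no_isolated (level f 1 :|: level f 2)].

Definition const2 : {ffun T -> 'I_3} := [ffun=> ord_max].

(* Each minimum is an [arg min] started at a feasible point; feasibility of the
   starting points is proved below.  For [gamma_oitR] it requires that the graph
   have no isolated vertex; otherwise the value is meaningless. *)

Definition vertex_cover_number : nat :=
  #|[arg min_(S < [set: T] | vertex_cover S) #|S|]|.

Definition domination_number : nat :=
  #|[arg min_(D < [set: T] | dominating D) #|D|]|.

Definition gamma_R : nat :=
  weight [arg min_(f < const2 | roman_dominating f) weight f].

Definition gamma_oitR : nat :=
  weight [arg min_(f < const2 | oit_roman_dominating f) weight f].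

Lemma vertex_coverT : vertex_cover [set: T].
Proof. by apply/forallP=> u; apply/forallP=> v; rewrite inE implybT. Qed.

Lemma dominatingT : dominating [set: T].
Proof. by apply/forall_inP=> v; rewrite !inE. Qed.

Lemma level_const2 i : level const2 i = if i == 2 then [set: T] else set0.
Proof.
by apply/setP=> v; rewrite inE ffunE /= eq_sym; case: eqP; rewrite inE.
Qed.

Lemma roman_dominating_const2 : roman_dominating const2.
Proof. by apply/forall_inP=> v; rewrite level_const2 inE. Qed.

Lemma oit_roman_dominating_const2 :
  no_isolated [set: T] -> oit_roman_dominating const2.
Proof.
move=> niT; rewrite /oit_roman_dominating roman_dominating_const2.
rewrite !level_const2 /= set0U niT andbT.
by apply/forall_inP=> v; rewrite inE.
Qed.

End GraphParameters.

(* Main.v *)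
Require Import Defs.
From mathcomp Require Import all_boot.

(** Let S be a minimum vertex cover and f a minimum Roman dominating function.
    For each vertex v of S, choose v itself if f v = 0 and any neighbour of v
    otherwise, and raise the value at the chosen vertex from 0 to 1 (leaving a
    positive value unchanged), at a cost of at most one unit per vertex of S.
    The new zeros avoid S, hence are independent, and the vertices of value 2
    are unchanged.  Every vertex of S is now positive and has a positive
    neighbour, and a vertex outside S has all its neighbours in S.  For the
    second inequality, give the value 2 to a minimum dominating set. *)

Set Implicit Arguments.
Unset Strict Implicit.
Unset Printing Implicit Defensive.

Section Bounds.
Variables (T : finType) (e : rel T).
Implicit Types (S D B : {set T}) (f : {ffun T -> 'I_3}).

(** The absence of isolated vertices makes [const2] feasible, so the [arg min] is a true minimum. *)
Lemma gamma_oitR_le f :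
  no_isolated e [set: T] -> oit_roman_dominating e f -> gamma_oitR e <= weight f.
Proof.
move=> niT f_oit; rewrite /gamma_oitR.
by case: arg_minnP => [|g _]; [exact: oit_roman_dominating_const2 | exact].
Qed.

Lemma gamma_R_le f : roman_dominating e f -> gamma_R e <= weight f.
Proof.
move=> f_rom; rewrite /gamma_R.
by case: arg_minnP => [|g _]; [exact: roman_dominating_const2 | exact].
Qed.

Definition raise f B : {ffun T -> 'I_3} :=
  [ffun v => if (f v == 0 :> nat) && (v \in B) then inord 1 else f v].

Lemma raiseE f B v :
  raise f B v = (if (f v == 0 :> nat) && (v \in B) then 1 else f v) :> nat.
Proof. by rewrite ffunE; case: ifP; rewrite ?inordK. Qed.

Lemma weight_raise f B : weight (raise f B) <= #|B| + weight f.
Proof.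
rewrite -sum1_card big_mkcond -big_split /=; apply: leq_sum => v _.
by rewrite raiseE; case: (v \in B); rewrite ?andbT ?andbF //=; case: eqP => // ->.
Qed.

Lemma raise_eq0 f B v :
  (raise f B v == 0 :> nat) = (f v == 0 :> nat) && (v \notin B).
Proof. by rewrite raiseE; case: (v \in B); case: (nat_of_ord (f v)). Qed.

Lemma raise_eq2 f B v : (raise f B v == 2 :> nat) = (f v == 2 :> nat).
Proof. by rewrite raiseE; case: (v \in B); case: (nat_of_ord (f v)). Qed.

Lemma level12E f : level f 1 :|: level f 2 = [set v | f v != 0 :> nat].
Proof. by apply/setP=> v; rewrite !inE; case: (f v) => -[|[|[|]]]. Qed.

(** Raising creates no new zero and keeps every 2, so the old neighbour of value 2 still serves. *)
Lemma roman_dominating_raise f B :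
  roman_dominating e f -> roman_dominating e (raise f B).
Proof.
move=> /forall_inP f_rom; apply/forall_inP=> v.
rewrite inE raise_eq0 => /andP[fv0 _].
have /f_rom/exists_inP[u] : v \in level f 0 by rewrite inE.
by rewrite inE => fu2 euv; apply/exists_inP; exists u; rewrite // inE raise_eq2.
Qed.

Lemma oit_roman_of_cover S f :
    no_isolated e [set: T] -> vertex_cover e S -> roman_dominating e f ->
  exists2 g, oit_roman_dominating e g & weight g <= #|S| + weight f.
Proof.
move=> /forall_inP niT /forallP coverS f_rom.
(* A neighbour is fixed for each vertex, so that the raised set is the image of [S] under a function
   and has at most [#|S|] elements. *)
have nbr v : {u | e v u}.
  by apply: sigW; have /exists_inP[u _ evu] := niT v (in_setT v); exists u.
pose h v := if f v == 0 :> nat then v else sval (nbr v).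
pose B := h @: S.
(* A zero of [f] in [S] selects itself under [h], hence lies in [B]. *)
have SP v : v \in S -> raise f B v != 0 :> nat.
  move=> vS; rewrite raise_eq0; case: eqP => //= /eqP fv0; rewrite negbK.
  by apply/imsetP; exists v; rewrite // /h fv0.
exists (raise f B); last first.
  by apply: leq_trans (weight_raise f B) _; rewrite leq_add2r leq_imset_card.
apply/and3P; split; first exact: roman_dominating_raise.
  apply/forall_inP=> u; rewrite inE => gu0.
  apply/forall_inP=> v; rewrite inE => gv0; apply/negP=> euv.
  (* An edge between two zeros would have an end in [S], which [SP] makes positive. *)
  have /forallP/(_ v)/implyP/(_ euv)/orP[/SP | /SP] := coverS u.
    by rewrite gu0.
  by rewrite gv0.
rewrite level12E; apply/forall_inP=> v _.
suff [u evu gu] : exists2 u, e v u & raise f B u != 0 :> nat.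
  by apply/exists_inP; exists u; rewrite ?inE.
have [vS | vNS] := boolP (v \in S); last first.
  have [u evu] := nbr v; exists u => //; apply: (SP u).
  have /forallP/(_ u)/implyP/(_ evu) := coverS v.
  by rewrite (negPf vNS).
(* If [f v] is 0, a neighbour of value 2 is available and stays positive; otherwise [h v] is a
   neighbour of [v] lying in [B]. *)
have [fv0 | fvN0] := boolP (f v == 0 :> nat).
  have /exists_inP[u] := forall_inP f_rom v (etrans (in_set _ _) fv0).
  by rewrite inE => /eqP fu2 evu; exists u; rewrite // raise_eq0 fu2.
exists (sval (nbr v)); first exact: (svalP (nbr v)).
rewrite raise_eq0 negb_and negbK; apply/orP; right.
by apply/imsetP; exists v; rewrite // /h (negPf fvN0).
Qed.

Lemma roman_of_dominating D :
    dominating e D ->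
  exists2 f, roman_dominating e f & weight f = 2 * #|D|.
Proof.
move=> /forall_inP domD.
pose f : {ffun T -> 'I_3} := [ffun v => if v \in D then ord_max else ord0].
exists f.
  apply/forall_inP=> v; rewrite inE ffunE => fv0.
  have /domD/exists_inP[u uD evu] : v \in ~: D by rewrite inE; case: (v \in D) fv0.
  by apply/exists_inP; exists u; rewrite // inE ffunE uD.
(* Both sides become sums over all vertices, equal term by term. *)
rewrite -sum1_card big_distrr big_mkcond /=; apply: eq_bigr => v _.
by rewrite ffunE; case: (v \in D).
Qed.

Lemma gamma_oitR_le_cover_roman :
  no_isolated e [set: T] -> gamma_oitR e <= vertex_cover_number e + gamma_R e.
Proof.
move=> niT; rewrite /vertex_cover_number /gamma_R.
case: arg_minnP => [|S coverS _]; first exact: vertex_coverT.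
case: arg_minnP => [|f f_rom _]; first exact: roman_dominating_const2.
have [g g_oit] := oit_roman_of_cover niT coverS f_rom.
exact: leq_trans (gamma_oitR_le niT g_oit).
Qed.

Lemma gamma_R_le_domination : gamma_R e <= 2 * domination_number e.
Proof.
rewrite /domination_number.
case: arg_minnP => [|D domD _]; first exact: dominatingT.
by have [f f_rom <-] := roman_of_dominating domD; exact: gamma_R_le.
Qed.

End Bounds.

Theorem theorem2p5 (T : finType) (e : rel T)
    (e_sym : symmetric e) (e_irrefl : irreflexive e)
    (e_no_isolated : no_isolated e [set: T]) :
  gamma_oitR e <= vertex_cover_number e + gamma_R e /\
  vertex_cover_number e + gamma_R e
    <= vertex_cover_number e + 2 * domination_number e.
Proof.
split; first exact: gamma_oitR_le_cover_roman.
by rewrite leq_add2l gamma_R_le_domination.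
Qed.
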